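(* Let $X$ be a real Banach space and let $F:[0,1]\to\mathrm{b}(X)$ be a Riemann integrable multifunction with $\int_0^1F(t)\,dt=A$. Then its convex hull $\operatorname{conv}F$ is also Riemann integrable and $\int_0^1\operatorname{conv}F(t)\,dt=\overline{\operatorname{conv}}\,A$, where $\overline{\operatorname{conv}}\,A$ denotes the closed convex hull of $A$.
   Context: Let $\mathrm{b}(X)$ be the collection of all non-empty bounded subsets of $X$ and $\mathrm{clb}(X)$ the subcollection of closed ones. A multifunction $F:[0,1]\to\mathrm{b}(X)$ is a map assigning to each $t\in[0,1]$ a non-empty bounded set $F(t)\subset X$. $\operatorname{conv}F$ is the multifunction $t\mapsto\operatorname{conv}(F(t))$ (ordinary convex hull, no closure taken). For $A,B\subset X$ and a scalar $\lambda$: $A+B=\{a+b: a\in A, b\in B\}$ (Minkowski sum), $\lambda A=\{\lambda a: a\in A\}$. The Hausdorff distance (a pseudometric on $\mathrm{b}(X)$) is $\rho_H(A,B)=\max\{\sup_{b\in B}\rho(b,A),\ \sup_{a\in A}\rho(a,B)\}$, where $\rho(x,A)=\inf_{a\in A}\|x-a\|$. A tagged partition $T=\{\Delta_i,t_i\}_{i=1}^n$ of $[0,1]$ consists of a partition of $[0,1]$ into consecutive intervals $\Delta_i=[x_{i-1},x_i]$, $0=x_0<\dots<x_n=1$, and points $t_i\in\Delta_i$; $d(T)=\max_i|\Delta_i|$, where $|\Delta_i|$ is the length. The Riemann sum is $S(F,T)=\sum_{i=1}^n|\Delta_i|F(t_i)$. $F$ is Riemann integrable if there is a set $A\in\mathrm{clb}(X)$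 (then unique, called the Riemann integral $\int_0^1F(t)\,dt$) such that for every $\varepsilon>0$ there is $\delta>0$ with $\rho_H(S(F,T),A)<\varepsilon$ for every tagged partition $T$ with $d(T)<\delta$. *)

(* Defs.v *)
From HB Require Import structures.
From mathcomp Require Import all_boot all_order all_algebra.
From mathcomp Require Import all_classical all_reals all_analysis.
Set Implicit Arguments.
Unset Strict Implicit.
Unset Printing Implicit Defensive.
Import Order.TTheory GRing.Theory Num.Theory.
Import numFieldNormedType.Exports.
Local Open Scope classical_set_scope.
Local Open Scope ring_scope.

Section sets.
Context {R : realType} {X : normedModType R}.
Implicit Types A B : set X.

Definition bset : set (set X) := [set A | A !=set0 /\ bounded_set A].

Definition clbset : set (set X) := [set A | bset A /\ closed A].

Definition minkowski_sum A B : set X := [set a + b | a in A & b in B].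

Definition minkowski_scale (l : R) A : set X := [set l *: a | a in A].

Definition conv_hull A : set X :=
  smallest (fun C : set X => convex_set (M := X) C) A.

Definition closed_conv_hull A : set X := closure (conv_hull A).

(* The distances are extended-real valued, so that the infima and suprema carry
   no side condition; on non-empty bounded sets they are finite. *)
Definition dist_to (x : X) A : \bar R := ereal_inf [set `|x - a|%:E | a in A].

Definition hausdorff_dist A B : \bar R :=
  maxe (ereal_sup [set dist_to b A | b in B])
       (ereal_sup [set dist_to a B | a in A]).

End sets.

(* [tp_seq] lists x_1 < ... < x_n = 1; the left endpoint x_0 = 0 is implicit in
   [itv_partition 0 1] and is restored by [tp_pt]. *)
Record tagged_partition (R : realType) := TaggedPartition {
  tp_seq : seq R ;
  tp_tag : 'I_(size tp_seq) -> R ;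
  tp_partition : itv_partition 0 1 tp_seq ;
  tp_tag_in : forall i : 'I_(size tp_seq),
    tp_tag i \in `[nth 1 (0 :: tp_seq) i, nth 1 (0 :: tp_seq) i.+1] }.

Section riemann.
Context {R : realType}.
Implicit Type T : tagged_partition R.

Definition tp_pt T (i : nat) : R := nth 1 (0 :: tp_seq T) i.

Definition tp_len T (i : nat) : R := tp_pt T i.+1 - tp_pt T i.

Definition mesh T : R := \big[Num.max/0]_(i < size (tp_seq T)) tp_len T i.

Context {X : normedModType R}.
Implicit Types (F : R -> set X) (A : set X).

(* Only the values of [F] on [0, 1] are ever used. *)
Definition multifunction F := forall t : R, t \in `[0, 1] -> bset (F t).

Definition riemann_sum F T : set X :=
  \big[minkowski_sum/[set 0]]_(i < size (tp_seq T))
    minkowski_scale (tp_len T i) (F (tp_tag i)).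

Definition is_riemann_integral F A :=
  [/\ multifunction F, clbset A &
      forall e : R, 0 < e -> exists2 d : R, 0 < d &
        forall T, mesh T < d -> (hausdorff_dist (riemann_sum F T) A < e%:E)%E].

Definition riemann_integrable F := exists A, is_riemann_integral F A.

End riemann.

(* Main.v *)
Require Import Defs.
From mathcomp Require Import all_boot all_order all_algebra.
From mathcomp Require Import all_classical all_reals all_analysis.
Local Open Scope classical_set_scope.
Local Open Scope ring_scope.

Import Order.TTheory GRing.Theory Num.Theory.

(** Why it holds.  Two facts about convex hulls carry the proof.

    Convex hulls commute with scalar multiples and Minkowski sums, so the
    Riemann sums of the convexified multifunction are exactly the convex hulls
    of the Riemann sums of the original one ([riemann_sum_conv_hull]).

    Passing from [A] and [B] to [conv A] and to the closed convex hull of [B]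
    does not increase their Hausdorff distance ([hausdorff_dist_conv_hull]).
    This rests on one remark: for a convex set [C] the points at distance at
    most [r] from [C] form a closed convex set.  As soon as this neighbourhood
    contains a set, it contains its closed convex hull.

    A mesh that works for [F] and a given tolerance therefore works for
    [conv F] and the same tolerance.  The same remark with [C] a point says that
    closed balls are convex and closed, which is why hulls stay bounded. *)

Section convex_hull.
Context {R : realType} {X : normedModType R}.
Implicit Types A B C : set X.

(** Membership in [convex_set] is boolean; this form with propositional
    membership can be applied to sets given by comprehension. *)
Lemma convex_setP (A : set X) : convex_set (M := X) A <->
  forall (k : {i01 R}) (x y : X), A x -> A y ->
    A (k%:num *: x + (1 - k%:num) *: y).
Proof.
split=> [cA k x y Ax Ay|cA x y k]; last first.
  by rewrite !inE => Ax Ay; exact: cA.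
by have := cA x y k; rewrite !inE; apply.
Qed.

Lemma sub_conv_hull A : A `<=` conv_hull A.
Proof. exact: sub_gen_smallest. Qed.

Lemma conv_hull_sub A C : convex_set (M := X) C -> A `<=` C ->
  conv_hull A `<=` C.
Proof. exact: smallest_sub. Qed.

Lemma convex_conv_hull A : convex_set (M := X) (conv_hull A).
Proof.
apply/convex_setP => k x y Ax Ay C [cC AC].
by have /convex_setP := cC; apply; [apply: Ax|apply: Ay].
Qed.

Lemma conv_hull_id C : convex_set (M := X) C -> conv_hull C = C.
Proof. exact: smallest_id. Qed.

Lemma convex_set1 (a : X) : convex_set (M := X) [set a].
Proof.
by apply/convex_setP => k _ _ -> ->; rewrite /= -scalerDl subrKC scale1r.
Qed.

Lemma convex_scale (l : R) C : convex_set (M := X) C ->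
  convex_set (M := X) (minkowski_scale l C).
Proof.
move/convex_setP => cC; apply/convex_setP => k _ _ [x Cx <-] [y Cy <-].
by exists (k%:num *: x + (1 - k%:num) *: y); [exact: cC|];
  rewrite scalerDr !scalerA ![l * _]mulrC.
Qed.

Lemma convex_sum A B : convex_set (M := X) A -> convex_set (M := X) B ->
  convex_set (M := X) (minkowski_sum A B).
Proof.
move=> /convex_setP cA /convex_setP cB; apply/convex_setP.
move=> k _ _ [a Aa [b Bb <-]] [a' Aa' [b' Bb' <-]].
exists (k%:num *: a + (1 - k%:num) *: a'); first exact: cA.
exists (k%:num *: b + (1 - k%:num) *: b'); first exact: cB.
by rewrite !scalerDr addrACA.
Qed.

(** This form makes sense of dividing a convex set by [l] even when [l = 0],
    a value for which the scaling has no inverse. *)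
Lemma convex_preimage_scale (l : R) C : convex_set (M := X) C ->
  convex_set (M := X) [set x | C (l *: x)].
Proof.
move=> /convex_setP cC; apply/convex_setP => k x y /= Cx Cy.
by have := cC k _ _ Cx Cy; rewrite scalerDr !scalerA ![_ * l]mulrC.
Qed.

Lemma convex_preimage_translate (b : X) C : convex_set (M := X) C ->
  convex_set (M := X) [set x | C (x + b)].
Proof.
move=> /convex_setP cC; apply/convex_setP => k x y /= Cx Cy.
have := cC k _ _ Cx Cy; rewrite !scalerDr addrACA.
by rewrite -scalerDl subrKC scale1r.
Qed.

Lemma conv_hull_scale (l : R) A :
  conv_hull (minkowski_scale l A) = minkowski_scale l (conv_hull A).
Proof.
apply/seteqP; split.
  apply: conv_hull_sub; first exact/convex_scale/convex_conv_hull.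
  by move=> _ [a Aa <-]; exists a => //; exact: sub_conv_hull.
move=> _ [x Ax <-]; move: x Ax.
apply: conv_hull_sub; first exact/convex_preimage_scale/convex_conv_hull.
by move=> a Aa /=; apply: sub_conv_hull; exists a.
Qed.

(** For the inclusion from right to left, one summand is convexified at a time:
    with the other one fixed, the translations that keep the sum in the hull form
    a convex set. *)
Lemma conv_hull_sum A B :
  conv_hull (minkowski_sum A B) = minkowski_sum (conv_hull A) (conv_hull B).
Proof.
apply/seteqP; split.
  apply: conv_hull_sub; first by apply: convex_sum; exact: convex_conv_hull.
  move=> _ [a Aa [b Bb <-]].
  by exists a; [|exists b => //]; exact: sub_conv_hull.
have half b : B b -> conv_hull A `<=` [set x | conv_hull (minkowski_sum A B) (x + b)].
  move=> Bb; apply: conv_hull_sub.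
    exact/convex_preimage_translate/convex_conv_hull.
  by move=> a Aa /=; apply: sub_conv_hull; exists a => //; exists b.
move=> _ [x Ax [y By <-]]; rewrite addrC; move: y By.
apply: conv_hull_sub; first exact/convex_preimage_translate/convex_conv_hull.
by move=> b Bb /=; rewrite addrC; exact: half.
Qed.

(** Convex hull is a morphism for Minkowski sums, with [[set 0]] as its own
    hull, hence commutes with the finite sum. *)
Lemma riemann_sum_conv_hull (F : R -> set X) (T : tagged_partition R) :
  riemann_sum (fun t => conv_hull (F t)) T = conv_hull (riemann_sum F T).
Proof.
rewrite /riemann_sum (big_morph _ conv_hull_sum (conv_hull_id _ (convex_set1 0))).
by apply: eq_bigr => i _; rewrite conv_hull_scale.
Qed.

End convex_hull.

Section distance.
Context {R : realType} {X : normedModType R}.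
Implicit Types (A B C : set X) (r : \bar R).

Lemma dist_to_lt x A (s : R) : (dist_to x A < s%:E)%E ->
  exists2 a, A a & `|x - a| < s.
Proof. by move=> /ereal_inf_lt[_ [a Aa <-]]; rewrite lte_fin; exists a. Qed.

Lemma dist_to_le x A a : A a -> (dist_to x A <= `|x - a|%:E)%E.
Proof. by move=> Aa; apply: ereal_inf_lbound; exists a. Qed.

Lemma dist_to_set1 (x a : X) : dist_to x [set a] = `|x - a|%:E.
Proof. by rewrite /dist_to image_set1 ereal_inf1. Qed.

Lemma le_dist_to x A B : A `<=` B -> (dist_to x B <= dist_to x A)%E.
Proof. by move=> AB; apply/ereal_inf_le_tmp/image_subset. Qed.

(** Infima need not be attained: this reduces a bound on a distance to bounds
    by strictly larger reals, for each of which a near point exists. *)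
Lemma lee_fin_above (u v : \bar R) :
  (forall s : R, (v < s%:E)%E -> (u <= s%:E)%E) -> (u <= v)%E.
Proof.
move=> uv; rewrite leNgt; apply/negP => vu.
have [s vs su] : exists2 s : R, (v < s%:E)%E & (s%:E < u)%E.
  case: u v vu {uv} => [u| |] [v| |] //=.
  - rewrite lte_fin => vu; exists ((v + u) / 2); rewrite lte_fin.
      by rewrite midf_lt.
    by rewrite midf_lt.
  - by exists (u - 1); rewrite ?ltNyr// lte_fin gtrDl ltrN10.
  - by exists (v + 1); rewrite ?ltry// lte_fin ltrDl ltr01.
  - by exists 0; rewrite ?ltNyr ?ltry.
by have := lt_le_trans su (uv _ vs); rewrite ltxx.
Qed.

(** If [a] and [b] in [C] are near [x] and [y], the convex combination of [a]
    and [b] is as near to that of [x] and [y], by convexity of the norm. *)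
Lemma convex_dist_to_le C r : convex_set (M := X) C ->
  convex_set (M := X) [set x | (dist_to x C <= r)%E].
Proof.
move=> /convex_setP cC; apply/convex_setP => k x y /= xr yr.
apply: lee_fin_above => s rs.
have [a Ca xa] := dist_to_lt _ _ _ (le_lt_trans xr rs).
have [b Cb yb] := dist_to_lt _ _ _ (le_lt_trans yr rs).
apply: le_trans (dist_to_le _ _ _ (cC k _ _ Ca Cb)) _.
rewrite lee_fin opprD addrACA -!scalerBr (le_trans (ler_normD _ _))//.
have k1 : 0 <= 1 - k%:num by rewrite subr_ge0.
rewrite !normrZ !ger0_norm//.
rewrite -[leRHS]mul1r -[in leRHS](subrKC k%:num 1) [leRHS]mulrDl.
by rewrite lerD// ler_wpM2l// ltW.
Qed.

(** A point [x] of the closure has points [y] of the set arbitrarily near, and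
    a point of [A] near [y] is near [x]; the margin between [r] and [s] pays for
    the step from [x] to [y]. *)
Lemma closed_dist_to_le A r : closed [set x | (dist_to x A <= r)%E].
Proof.
move=> x clx; apply: lee_fin_above => s rs.
have [s' [rs' s's]] : exists s' : R, (r < s'%:E)%E /\ s' < s.
  case: r rs {clx} => [r| |] //=.
  - rewrite lte_fin => rs; exists ((r + s) / 2); rewrite lte_fin.
    by rewrite !midf_lt.
  - by move=> _; exists (s - 1); rewrite ltNyr gtrDl ltrN10.
have ss0 : 0 < s - s' by rewrite subr_gt0.
have [y [/= yr]] := clx _ (nbhsx_ballx x _ ss0).
rewrite -ball_normE /= => xy.
have [a Aa ya] := dist_to_lt _ _ _ (le_lt_trans yr rs').
apply: le_trans (dist_to_le _ _ _ Aa) _.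
rewrite lee_fin -(subrKA y) (le_trans (ler_normD _ _))//.
by rewrite -(subrK s' s) lerD// ltW.
Qed.

(** The points at distance at most [r] from [conv_hull B] form a closed convex
    set; it contains [A] because enlarging [B] only shortens distances. *)
Lemma dist_to_closed_conv_hull A B r :
  (forall a, A a -> (dist_to a B <= r)%E) ->
  forall x, closed_conv_hull A x -> (dist_to x (conv_hull B) <= r)%E.
Proof.
move=> ABr; rewrite /closed_conv_hull closureE.
apply: smallest_sub; first exact: closed_dist_to_le.
apply: conv_hull_sub; first exact/convex_dist_to_le/convex_conv_hull.
by move=> a Aa /=; exact: le_trans (le_dist_to _ _ _ (sub_conv_hull B)) (ABr _ Aa).
Qed.

(** The closure is taken on one side only, as needed to compare Riemann sums,
    which need not be closed, with their limit. *)
Lemma hausdorff_dist_conv_hull A B :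
  (hausdorff_dist (conv_hull A) (closed_conv_hull B) <= hausdorff_dist A B)%E.
Proof.
rewrite /hausdorff_dist ge_max !le_max; apply/andP; split; apply/orP.
- left; apply: ge_ereal_sup => _ [x Bx <-].
  apply: dist_to_closed_conv_hull Bx => b Bb.
  by apply: ereal_sup_ubound; exists b.
- right; apply: ge_ereal_sup => _ [x Ax <-].
  apply: (@le_trans _ _ (dist_to x (conv_hull B))).
    exact: le_dist_to (@subset_closure _ _).
  apply: dist_to_closed_conv_hull (subset_closure Ax) => a Aa.
  by apply: ereal_sup_ubound; exists a.
Qed.

(** Boundedness is a bound on distances to the convex set [[set 0]], and such a
    bound passes to the closed convex hull. *)
Lemma bset_closed_conv_hull A : bset A -> bset (closed_conv_hull A).
Proof.
move=> [[a Aa] [M [Mreal AM]]]; split.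
  by exists a; exact: subset_closure (sub_conv_hull _ _ Aa).
exists M; split=> // N MN x Ax; rewrite /= -lee_fin -[x]subr0 -dist_to_set1.
rewrite -(conv_hull_id _ (convex_set1 0)).
apply: dist_to_closed_conv_hull Ax => b Ab.
by rewrite dist_to_set1 subr0 lee_fin; exact: AM Ab.
Qed.

Lemma bset_conv_hull A : bset A -> bset (conv_hull A).
Proof.
move=> bA; have [_ [M [Mreal clAM]]] := bset_closed_conv_hull A bA.
split; first by case: bA => -[a Aa] _; exists a; exact: sub_conv_hull.
by exists M; split=> // N MN x /subset_closure; exact: clAM.
Qed.

End distance.

Theorem theorem1p6 (R : realType) (X : completeNormedModType R)
    (F : R -> set X) (A : set X) :
  multifunction F ->
  is_riemann_integral F A ->
  riemann_integrable (fun t => conv_hull (F t)) /\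
  is_riemann_integral (fun t => conv_hull (F t)) (closed_conv_hull A).
Proof.
move=> bF [_ [bA _] intF].
suff intcF : is_riemann_integral (fun t => conv_hull (F t)) (closed_conv_hull A).
  by split=> //; exists (closed_conv_hull A).
split.
- by move=> t /bF; exact: bset_conv_hull.
- by split; [exact: bset_closed_conv_hull|exact: closed_closure].
- move=> e /intF[d d0 Fd]; exists d => // T /Fd; apply: le_lt_trans.
  by rewrite riemann_sum_conv_hull; exact: hausdorff_dist_conv_hull.
Qed.
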